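(* Consider the one-dimensional Allen–Cahn equation $\partial_t\rho=-\mathcal{M}(\rho)(-\epsilon^2\partial_{xx}\rho+F'(\rho))$ with $\mathcal{M}(\rho)>0$, $F(\rho)=\frac14(\rho^2-1)^2$. Let $\eta\ge0$ and suppose the time-step ratios satisfy $0<r_k\le r_{\max}$ for all $k$. Let $n\ge1$ and let $x^{n+1}=(x_0^{n+1},\dots,x_{M_x}^{n+1})$ be obtained from $x^{n-1},x^n$ by the fully discrete scheme, for $j=0,\dots,M_x-1$, $$ \begin{aligned} &\frac{(2r_{n+1}+1)(\rho_0'(X_{j+\frac12}))^2}{2\tau_{n+1}(r_{n+1}+1)\mathcal{M}(\rho_0(X_{j+\frac12}))}\left((D_hx^{n+1})_{j+\frac12}^{-1}+(D_hx^{n})_{j+\frac12}^{-1}\right)(x_{j+\frac12}^{n+1}-x_{j+\frac12}^{n})\\ &-\eta\tau_{n+1}D_h\left(\log(d_hx^{n+1})-\log(d_hx^{n})\right)_{j+\frac12}\\ &-\frac{r_{n+1}^2(\rho_0'(X_{j+\frac12}))^2}{2\tau_{n+1}(r_{n+1}+1)\mathcal{M}(\rho_0(X_{j+\frac12}))}\left(\Big(1+\frac{1}{2r_{n+1}}\Big)(D_hx^n)_{j+\frac12}^{-\frac12}-\frac{1}{2r_{n+1}}(D_hx^{n+1})_{j+\frac12}^{-\frac12}\right)\\ &\qquad\times\left((D_hx^{n-1})_{j+\frac12}^{-\frac12}+(D_hx^n)_{j+\frac12}^{-\frac12}\right)(x_{j+\frac12}^{n}-x_{j+\frac12}^{n-1})\\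 &=-\frac{\epsilon^2}{2}D_h\left((\rho_0'(X)(d_hx^{n+1})^{-1})^2\right)_{j+\frac12}+D_hF(\rho_0(X))_{j+\frac12} \end{aligned} $$ with $x_0^{n+1}=X_0$, $x_{M_x}^{n+1}=X_{M_x}$. If $0<r_{\max}\le\frac32$, then the scheme is energy dissipative in the sense that $$ \begin{aligned} &E_h^{n+1}+\frac{r_{\max}}{2\tau_{n+1}(r_{\max}+1)}\left(\frac{(\rho_0')^2}{\mathcal{M}(\rho_0)}\big((D_hx^{n+1})^{-1}+(D_hx^{n})^{-1}\big)(x^{n+1}-x^{n}),\,x^{n+1}-x^{n}\right)_h\\ &+\eta\tau_{n+1}\left[\log(d_hx^{n+1})-\log(d_hx^{n}),\,d_h(x^{n+1}-x^n)\right]_h\\ &\le E_h^{n}+\frac{r_{\max}}{2\tau_{n}(r_{\max}+1)}\left(\frac{(\rho_0')^2}{\mathcal{M}(\rho_0)}\big((D_hx^{n-1})^{-1}+(D_hx^{n})^{-1}\big)(x^{n}-x^{n-1}),\,x^{n}-x^{n-1}\right)_h, \end{aligned} $$ where $$E_h^k=\frac{\epsilon^2}{2}\left[|\rho_0'(X)(d_hx^k)^{-1}|^2,\,d_hx^k\right]_h+\left[F(\rho_0(X)),\,d_hx^k\right]_h.$$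
   Context: $\Omega=[-L,L]$ with uniform Lagrangian grid $-L=X_0<X_1<\dots<X_{M_x}=L$, $h=2L/M_x$; $\rho_0$ is the initial datum and $\epsilon>0$ a constant. For a grid function $x=(x_0,\dots,x_{M_x})$ put $x_{j+\frac12}=\frac12(x_j+x_{j+1})$ (likewise $X_{j+\frac12}$), $(D_hx)_{j+\frac12}=\frac1h(x_{j+1}-x_j)$ for $0\le j\le M_x-1$ (also applied to any quantity given at nodes), and $(d_hx)_j=\frac1h(x_{j+\frac12}-x_{j-\frac12})$ for $1\le j\le M_x-1$, with the one-sided boundary values $(d_hx)_0=\frac{2}{h}(x_{\frac12}-x_0)$ and $(d_hx)_{M_x}=\frac2h(x_{M_x}-x_{M_x-\frac12})$. Discrete inner products: $$(u,v)_h=\sum_{j=0}^{M_x-1}(uv)_{j+\frac12}h\ \text{(for half-point values)},\qquad [u,v]_h=\sum_{j=1}^{M_x-1}(uv)_jh+\frac h2(u_0v_0+u_{M_x}v_{M_x})\ \text{(for nodal values)}.$$ If $v_0=v_{M_x}=0$, then $(D_hu,v)_h=-[u,d_hv]_h$. All grid maps $x^{n-1},x^n,x^{n+1}$ satisfy $x_0=X_0$, $x_{M_x}=X_{M_x}$ and are strictly increasing in $j$ (positive discrete Jacobians), so that the powers and logarithms are defined. Time steps $\tau_k=t^k-t^{k-1}>0$, $r_{k+1}=\tau_{k+1}/\tau_k$, with uniform upper bound $r_{\max}$. *)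

(* Defs.v *)
From HB Require Import structures.
From mathcomp Require Import all_boot all_order all_algebra.
From mathcomp Require Import all_classical all_reals all_analysis.

Set Implicit Arguments.
Unset Strict Implicit.
Unset Printing Implicit Defensive.

Import Order.TTheory GRing.Theory Num.Theory.
Import numFieldNormedType.Exports.

Local Open Scope classical_set_scope.
Local Open Scope ring_scope.

(* Derivative of a function given on a subset A of the real line: the limit of
   the difference quotient along points of A, hence one-sided at an endpoint
   when A is a closed interval. *)
Section DerivativeOn.
Context {R : realType}.
Implicit Types (A : set R) (f : R -> R) (x : R).

Definition diff_quotient_on A f x : set_system R :=
  (fun y => (f y - f x) / (y - x)) @ within A x^'.

Definition derivable_on A f : Prop :=
  forall x, A x -> cvg (diff_quotient_on A f x).

Definition derive_on A f x : R := lim (diff_quotient_on A f x).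

End DerivativeOn.

(* Grid quantities are functions nat -> R.  A nodal quantity u is meaningful at
   the indices 0, ..., M; a half-point quantity v stores its value at the point
   of index j + 1/2 as v j, and is meaningful at 0, ..., M - 1.  No definition
   below reads a value outside these ranges when 0 < M. *)
Section Grid.
Context {R : realType}.
Implicit Types (L h : R) (M j : nat) (u v x : nat -> R).

Definition mesh L M : R := 2 * L / M%:R.

Definition lagr L M j : R := - L + j%:R * mesh L M.

Definition mid u j : R := (u j + u j.+1) / 2.

Definition Dh h u j : R := (u j.+1 - u j) / h.

Definition dh h M x j : R :=
  if j == 0%N then 2 / h * (mid x 0 - x 0%N)
  else if j == M then 2 / h * (x M - mid x M.-1)
  else (mid x j - mid x j.-1) / h.

Definition ip_half h M u v : R := \sum_(0 <= j < M) u j * v j * h.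

Definition ip_node h M u v : R :=
  \sum_(1 <= j < M) u j * v j * h + h / 2 * (u 0%N * v 0%N + u M * v M).

Definition admissible L M x : Prop :=
  [/\ x 0%N = lagr L M 0, x M = lagr L M M &
      forall j, (j < M)%N -> x j < x j.+1].

End Grid.

Section TimeGrid.
Context {R : realType}.
Implicit Types (t : nat -> R) (k : nat).

(* Meaningful for 1 <= k. *)
Definition time_step t k : R := t k - t k.-1.

(* Meaningful for 2 <= k. *)
Definition step_ratio t k : R := time_step t k / time_step t k.-1.

End TimeGrid.

Section AllenCahn.
Context {R : realType}.
Variables (L : R) (M : nat) (eps eta : R) (rho0 mob : R -> R).

Local Notation h := (mesh L M).
Local Notation X := (lagr L M).

Definition Fpot (s : R) : R := (s ^+ 2 - 1) ^+ 2 / 4.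

Definition drho0 (s : R) : R := derive_on `[- L, L] rho0 s.

Definition weight (j : nat) : R := (drho0 (mid X j)) ^+ 2 / mob (rho0 (mid X j)).

Definition energy (x : nat -> R) : R :=
  eps ^+ 2 / 2 *
    ip_node h M (fun j => `|drho0 (X j) * (dh h M x j)^-1| ^+ 2) (dh h M x)
  + ip_node h M (fun j => Fpot (rho0 (X j))) (dh h M x).

(* The equation of the scheme at the point of index j + 1/2, with time step
   tau1 and step ratio r; xm, x0, xp are the grid maps at the time levels n - 1,
   n and n + 1. *)
Definition scheme_eq (tau1 r : R) (xm x0 xp : nat -> R) (j : nat) : Prop :=
  (2 * r + 1) * (drho0 (mid X j)) ^+ 2
      / (2 * tau1 * (r + 1) * mob (rho0 (mid X j)))
    * ((Dh h xp j)^-1 + (Dh h x0 j)^-1) * (mid xp j - mid x0 j)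
  - eta * tau1 * Dh h (fun i => ln (dh h M xp i) - ln (dh h M x0 i)) j
  - r ^+ 2 * (drho0 (mid X j)) ^+ 2
      / (2 * tau1 * (r + 1) * mob (rho0 (mid X j)))
    * ((1 + 1 / (2 * r)) * (Dh h x0 j) `^ (- (1 / 2))
       - 1 / (2 * r) * (Dh h xp j) `^ (- (1 / 2)))
    * ((Dh h xm j) `^ (- (1 / 2)) + (Dh h x0 j) `^ (- (1 / 2)))
    * (mid x0 j - mid xm j)
  = - (eps ^+ 2 / 2) * Dh h (fun i => (drho0 (X i) * (dh h M xp i)^-1) ^+ 2) j
    + Dh h (fun i => Fpot (rho0 (X i))) j.

(* ((rho0')^2 / mob(rho0) ((D_h x)^-1 + (D_h y)^-1) (y - x), y - x)_h *)
Definition kinetic (x y : nat -> R) : R :=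
  ip_half h M
    (fun j => weight j * ((Dh h x j)^-1 + (Dh h y j)^-1) * (mid y j - mid x j))
    (fun j => mid y j - mid x j).

(* [log(d_h y) - log(d_h x), d_h (y - x)]_h *)
Definition log_term (x y : nat -> R) : R :=
  ip_node h M (fun j => ln (dh h M y j) - ln (dh h M x j))
    (dh h M (fun j => y j - x j)).

End AllenCahn.

(* Main.v *)
Require Import Defs.
From HB Require Import structures.
From mathcomp Require Import all_boot all_order all_algebra.
From mathcomp Require Import all_classical all_reals all_analysis.
From mathcomp Require Import ring lra.

Set Implicit Arguments.
Unset Strict Implicit.
Unset Printing Implicit Defensive.

Import Order.TTheory GRing.Theory Num.Theory.
Import numFieldNormedType.Exports.

Local Open Scope classical_set_scope.
Local Open Scope ring_scope.

(** The scheme is tested with the increment [p] of the half-point values of the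
    grid map, multiplied by [h] and summed.

    Every term of the scheme other than the two kinetic ones is a [Dh] of a
    nodal quantity [G], and the increment vanishes at both ends of the grid, so
    summation by parts ([ip_half_Dh]) turns the sum into minus the nodal product
    of [G] with the increment of [dh].  In that product the logarithm gives the
    regularisation term of the estimate exactly and the potential gives exactly
    the increment of the second part of the energy, which is linear in [dh].
    The first part of the energy is a weighted sum of [1 / s] over the values
    [s] of [dh], and it is discretised implicitly: by convexity ([inv_tangent_le]) its
    increment is at most the product with the slope at the new level.  Hence
    the energy increment plus the regularisation term is at most minus the
    kinetic sum.

    What remains is pointwise.  With [A], [B], [C] the values of
    [(Dh x)^(-1/2)] at the levels [n + 1], [n], [n - 1], and [p], [q] the new
    and old increments, the kinetic part is a multiple of
    [(2 r + 1) (A^2 + B^2) p^2 - r ((2 r + 1) B - A) (B + C) p q / 2].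
    Since [A] and [B] have the same sign,
    [((2 r + 1) B - A)^2 <= (2 r + 1)^2 (A^2 + B^2)], and
    [(B + C)^2 <= 2 (B^2 + C^2)]; Young's inequality, with the weight chosen so
    that the [q^2] part equals the kinetic term of the old level, leaves a
    scalar condition on [r] and [rmax].  It holds for [0 < r <= rmax <= 3 / 2]
    ([ratio_condition]). *)

(** * Quadrature and summation by parts *)

Section Quadrature.
Context {R : realType}.
Implicit Types (h : R) (M j : nat) (u v x y : nat -> R).

(** The trapezoidal weights: with them [ip_node] is one sum over all nodes, so
    that nodal estimates can be made pointwise. *)
Definition node_weight h M j : R :=
  if (j == 0%N) || (j == M) then h / 2 else h.

Lemma ip_nodeE h M u v : (0 < M)%N ->
  ip_node h M u v = \sum_(0 <= j < M.+1) node_weight h M j * (u j * v j).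
Proof.
case: M => // m _.
rewrite /ip_node [in RHS]big_nat_recr //= [in RHS]big_nat_recl //=.
rewrite big_add1 /= /node_weight !eqxx /=.
rewrite [X in _ = _ + X + _](_ : _ =
  \sum_(0 <= i < m) u i.+1 * v i.+1 * h); first by ring.
apply: eq_big_nat => i /andP[_ im].
by rewrite eqSS (ltn_eqF im) mulrC.
Qed.

Lemma node_weight_ge0 h M j : 0 <= h -> 0 <= node_weight h M j.
Proof. by move=> h0; rewrite /node_weight; case: ifP => _ //; lra. Qed.

Lemma midB x y j : mid (fun i => y i - x i) j = mid y j - mid x j.
Proof. by rewrite /mid; ring. Qed.

Lemma dhB h M x y j :
  dh h M (fun i => y i - x i) j = dh h M y j - dh h M x j.
Proof. by rewrite /dh !midB; case: ifP => _; last case: ifP => _; ring. Qed.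

Lemma abel_summation u g m :
  \sum_(0 <= j < m.+1) (u j.+1 - u j) * g j =
  u m.+1 * g m - u 0%N * g 0%N - \sum_(1 <= j < m.+1) u j * (g j - g j.-1).
Proof.
elim: m => [|m IH]; first by rewrite big_nat1 big_geq //; ring.
by rewrite big_nat_recr //= IH [in RHS]big_nat_recr //=; ring.
Qed.

(** The one-sided values of [dh] at the ends carry the factor [2 / h] precisely
    so that, against the half weights of [ip_node], they produce the two
    boundary terms of Abel's summation. *)
Lemma ip_half_Dh h M u v : (0 < M)%N -> h != 0 -> v 0%N = 0 -> v M = 0 ->
  ip_half h M (Dh h u) (mid v) = - ip_node h M u (dh h M v).
Proof.
case: M => // m _ h0 v0 vM.
rewrite /ip_half /ip_node.
rewrite (eq_big_nat _ _ (F2 := fun j => (u j.+1 - u j) * mid v j)); last first.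
  by move=> j _; rewrite /Dh; field.
rewrite abel_summation.
rewrite [in RHS](eq_big_nat _ _ (F2 := fun j => u j * (mid v j - mid v j.-1)));
  last first.
  move=> j /andP[j1 jm]; rewrite /dh (ltn_eqF jm).
  by case: j j1 jm => //= j _ _; field.
by rewrite /dh /= eqxx v0 vM; field.
Qed.

Lemma dh_gt0 h M x j : (0 < M)%N -> 0 < h ->
  (forall i, (i < M)%N -> x i < x i.+1) -> (j <= M)%N -> 0 < dh h M x j.
Proof.
move=> M0 h0 xinc jM; rewrite /dh /mid.
case: eqP => [_|/eqP j0].
  by apply: mulr_gt0; [exact: divr_gt0|move: (xinc 0%N M0); lra].
case: eqP => [_|/eqP jM'].
  apply: mulr_gt0; first exact: divr_gt0.
  by case: M M0 xinc {jM} => // m _ xinc /=; move: (xinc m (ltnSn m)); lra.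
have ltjM : (j < M)%N by rewrite ltn_neqAle jM' jM.
apply: divr_gt0 => //; move: (xinc j ltjM).
case: j j0 {jM jM'} ltjM => // j _ ltjM /=.
by move: (xinc j (ltnW ltjM)); lra.
Qed.

End Quadrature.

(** * Scalar inequalities *)

Section Scalar.
Context {R : realType}.

(** The slope is taken at the new value [s1], as in an implicit scheme: this is
    the tangent at [s1] of the convex function [s^-1], evaluated at [s0]. *)
Lemma inv_tangent_le (s0 s1 : R) : 0 < s0 -> 0 < s1 ->
  s1^-1 - s0^-1 <= - (s1^-1) ^+ 2 * (s1 - s0).
Proof.
move=> s0p s1p; rewrite -subr_ge0.
have -> : - s1^-1 ^+ 2 * (s1 - s0) - (s1^-1 - s0^-1) =
  s0 * (s1^-1 - s0^-1) ^+ 2 by field; rewrite !gt_eqF.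
by rewrite mulr_ge0 ?sqr_ge0 // ltW.
Qed.

(** The difference of the two sides is concave in [K], so it is enough to look
    at the ends [K = r], where the claim reads [(2 r + 1)^2 <= 8 (r + 1)], and
    [K = 3 / 2]. *)
Lemma ratio_condition (r K : R) : 0 < r -> r <= K -> K <= 3 / 2 ->
  (2 * r + 1) ^+ 2 * (K + 1) ^+ 2 <= 8 * (r + 1) * (r * K + 2 * r + 1).
Proof.
move=> r0 rK K32.
have K1 : (K + 1) ^+ 2 <= (r + 1) ^+ 2 + (r + 7 / 2) * (K - r) by nra.
apply: (le_trans (ler_wpM2l (sqr_ge0 _) K1)).
(* With (K + 1)^2 replaced by its chord over [r, 3 / 2], [- P] is the slope of
   the difference in [K]. *)
set P := 4 * r ^+ 3 + 10 * r ^+ 2 + 7 * r + 7 / 2.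
have P0 : 0 <= P by rewrite /P; nra.
have eP : (K - r) * P <= (3 / 2 - r) * P by apply: ler_wpM2r => //; lra.
rewrite -subr_ge0.
have -> : 8 * (r + 1) * (r * K + 2 * r + 1) -
    (2 * r + 1) ^+ 2 * ((r + 1) ^+ 2 + (r + 7 / 2) * (K - r)) =
  (7 + 4 * r - 4 * r ^+ 2) * (r + 1) ^+ 2 - (K - r) * P
  by rewrite /P; field.
have -> : (7 + 4 * r - 4 * r ^+ 2) * (r + 1) ^+ 2 - (K - r) * P =
  3 * r ^+ 2 + 11 * r + 7 / 4 + ((3 / 2 - r) * P - (K - r) * P)
  by rewrite /P; field.
nra.
Qed.

(** Young's inequality is used with the weight
    [2 K (r + 1) / (K + 1)], which makes the [q ^+ 2] part saturate the
    right-hand side once [(B + C) ^+ 2] is bounded by [2 (B ^+ 2 + C ^+ 2)]. *)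
Lemma kinetic_pointwise (r K A B C p q : R) :
  0 < r -> r <= K -> K <= 3 / 2 -> 0 < A -> 0 < B ->
  K / (K + 1) * (A ^+ 2 + B ^+ 2) * p ^+ 2
    - (2 * r + 1) / (r + 1) * (A ^+ 2 + B ^+ 2) * p ^+ 2
    + r / (2 * (r + 1)) * ((2 * r + 1) * B - A) * (C + B) * q * p
  <= r * K / (K + 1) * (C ^+ 2 + B ^+ 2) * q ^+ 2.
Proof.
move=> r0 rK K32 A0 B0.
have K0 : 0 < K by apply: lt_le_trans rK.
set W := (2 * r + 1) * B - A.
set S := A ^+ 2 + B ^+ 2.
set T := C ^+ 2 + B ^+ 2.
have WS : W ^+ 2 <= (2 * r + 1) ^+ 2 * S.
  (* The cross term is where positivity of [A] and [B] is needed: without it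
     the constant would be [(2 r + 1) ^+ 2 + 1]. *)
  have AB : 0 < A * B by rewrite mulr_gt0.
  rewrite -subr_ge0 (_ : _ - _ =
    (4 * r ^+ 2 + 4 * r) * A ^+ 2 + 2 * (2 * r + 1) * (A * B)); last first.
    by rewrite /W /S; ring.
  by rewrite addr_ge0 // mulr_ge0 ?sqr_ge0 ?(ltW AB) //; nra.
have CBT : (C + B) ^+ 2 <= 2 * T by rewrite /T; have := sqr_ge0 (C - B); nra.
have S0 : 0 <= S by rewrite /S addr_ge0 ?sqr_ge0.
pose th := 2 * K * (r + 1) / (K + 1).
have th0 : 0 < th by apply: divr_gt0; [apply: mulr_gt0|]; lra.
have young : W * (C + B) * q * p <= th * T * q ^+ 2
    + (2 * r + 1) ^+ 2 / (2 * th) * S * p ^+ 2.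
  have Y : W * (C + B) * q * p <= th / 2 * ((C + B) * q) ^+ 2
      + (W * p) ^+ 2 / (2 * th).
    rewrite -subr_ge0 (_ : _ - _ =
      (th * ((C + B) * q) - W * p) ^+ 2 / (2 * th)); last first.
      by field; rewrite gt_eqF.
    by rewrite divr_ge0 ?sqr_ge0 // mulr_ge0 // ltW.
  apply: (le_trans Y); apply: lerD.
    rewrite exprMn (_ : th * T * _ = th / 2 * (2 * T * q ^+ 2)); last by field.
    apply: ler_wpM2l; first by lra.
    by apply: ler_wpM2r => //; exact: sqr_ge0.
  rewrite exprMn (_ : _ / (2 * th) * S * _ =
    (2 * r + 1) ^+ 2 * S * p ^+ 2 / (2 * th)); last by ring.
  apply: ler_wpM2r; first by rewrite invr_ge0 mulr_ge0 // ltW.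
  by apply: ler_wpM2r => //; exact: sqr_ge0.
have r2 : 0 < r / (2 * (r + 1)) by apply: divr_gt0; lra.
have := ler_wpM2l (ltW r2) young.
rewrite (_ : _ * (W * (C + B) * q * p) =
  r / (2 * (r + 1)) * W * (C + B) * q * p); last by ring.
move=> Y.
have scal : r / (2 * (r + 1)) * ((2 * r + 1) ^+ 2 / (2 * th))
    <= (2 * r + 1) / (r + 1) - K / (K + 1).
  rewrite -subr_ge0 (_ : _ - _ =
    r * (8 * (r + 1) * (r * K + 2 * r + 1) - (2 * r + 1) ^+ 2 * (K + 1) ^+ 2)
      / (8 * K * (r + 1) ^+ 2 * (K + 1))
    + (K - r) * (r * K + 2 * r + 1) / (K * (r + 1) * (K + 1))); last first.
    by rewrite /th; field; rewrite !gt_eqF //; lra.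
  have rK0 : 0 < r * K by rewrite mulr_gt0.
  apply: addr_ge0; apply: divr_ge0.
  - by rewrite mulr_ge0 ?(ltW r0) // subr_ge0; apply: ratio_condition.
  - apply: mulr_ge0; last by lra.
    by apply: mulr_ge0; [lra|exact: sqr_ge0].
  - by apply: mulr_ge0; lra.
  - by apply: mulr_ge0; [apply: mulr_ge0|]; lra.
have Sp : 0 <= S * p ^+ 2 by rewrite mulr_ge0 ?sqr_ge0.
have := ler_wpM2r Sp scal.
have E : r / (2 * (r + 1)) * (th * T * q ^+ 2) = r * K / (K + 1) * T * q ^+ 2.
  by rewrite /th; field; rewrite !gt_eqF //; lra.
move: Y; rewrite [X in _ <= X]mulrDr E => Y Z.
rewrite (_ : r / (2 * (r + 1)) * ((2 * r + 1) ^+ 2 / (2 * th) * S * p ^+ 2) =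
  r / (2 * (r + 1)) * ((2 * r + 1) ^+ 2 / (2 * th)) * (S * p ^+ 2)) in Y;
  last by ring.
lra.
Qed.

Lemma powR_half_inv (s : R) : 0 < s -> (s `^ (- (1 / 2))) ^+ 2 = s^-1.
Proof.
move=> s0; rewrite expr2 -powRD; last by rewrite (gt_eqF s0) implybT.
by rewrite (_ : - (1 / 2) + - (1 / 2) = - 1) ?powR_inv1 ?ltW //; field.
Qed.

End Scalar.

(** * Energy dissipation *)

Theorem theorem4p1 (R : realType)
  (L : R) (L_gt0 : 0 < L) (M : nat) (M_gt0 : (0 < M)%N)
  (eps : R) (eps_gt0 : 0 < eps) (eta : R) (eta_ge0 : 0 <= eta)
  (rho0 : R -> R) (rho0_derivable : derivable_on `[- L, L] rho0)
  (mob : R -> R) (mob_gt0 : forall s : R, 0 < mob s)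
  (t : nat -> R) (tau_gt0 : forall k : nat, (1 <= k)%N -> 0 < time_step t k)
  (rmax : R)
  (ratio_bound : forall k : nat, (2 <= k)%N -> 0 < step_ratio t k /\ step_ratio t k <= rmax)
  (n : nat) (n_ge1 : (1 <= n)%N) (x : nat -> nat -> R)
  (xm_adm : admissible L M (x n.-1))
  (x0_adm : admissible L M (x n))
  (xp_adm : admissible L M (x n.+1))
  (x_scheme : forall j : nat, (j < M)%N ->
     scheme_eq L M eps eta rho0 mob (time_step t n.+1) (step_ratio t n.+1)
       (x n.-1) (x n) (x n.+1) j)
  (rmax_gt0 : 0 < rmax) (rmax_le : rmax <= 3 / 2) :
  energy L M eps rho0 (x n.+1)
    + rmax / (2 * time_step t n.+1 * (rmax + 1))
        * kinetic L M rho0 mob (x n) (x n.+1)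
    + eta * time_step t n.+1 * log_term L M (x n) (x n.+1)
  <= energy L M eps rho0 (x n)
    + rmax / (2 * time_step t n * (rmax + 1))
        * kinetic L M rho0 mob (x n.-1) (x n).
Proof.
set tau := time_step t n.+1; set r := step_ratio t n.+1.
have tau0 : 0 < tau by exact: tau_gt0.
have taun0 : 0 < time_step t n by exact: tau_gt0.
have [r0 rK] : 0 < r /\ r <= rmax by exact: ratio_bound.
have taunE : time_step t n = tau / r.
  by rewrite /r /step_ratio /= -/tau; field; rewrite !gt_eqF.
case: xm_adm => _ _ xm_inc.
case: x0_adm => x00 x0M x0_inc.
case: xp_adm => xp0 xpM xp_inc.
set xp := x n.+1 in xp0 xpM xp_inc x_scheme *.
set x0 := x n in x00 x0M x0_inc x_scheme *.
set xm := x n.-1 in xm_inc x_scheme *.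
set h := mesh L M.
have h0 : 0 < h.
  by rewrite /h /mesh divr_gt0 ?mulr_gt0 // ltr0n.
set X := lagr L M.
set d := dh h M.
set v := fun j => xp j - x0 j.
have [v0 vM] : v 0%N = 0 /\ v M = 0 by rewrite /v xp0 x00 xpM x0M !subrr.
(* The scheme reads: kinetic terms = Dh G.  In G the regularisation changes
   sides, hence its positive sign. *)
pose G := fun j => - (eps ^+ 2 / 2) * (drho0 L rho0 (X j) * (d xp j)^-1) ^+ 2
  + Fpot (rho0 (X j)) + eta * tau * (ln (d xp j) - ln (d x0 j)).
have energy_step : energy L M eps rho0 xp + eta * tau * log_term L M x0 xp
    <= energy L M eps rho0 x0 + ip_node h M G (d v).
  rewrite /energy /log_term !ip_nodeE // -/h !mulr_sumr -!big_split /=.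
  rewrite !big_nat; apply: ler_sum => j /andP[_ jM].
  have W0 := @node_weight_ge0 _ h M j (ltW h0).
  have dp := dh_gt0 M_gt0 h0 xp_inc jM.
  have d0 := dh_gt0 M_gt0 h0 x0_inc jM.
  rewrite /G /d -/X !real_normK ?num_real // !exprMn !dhB.
  have conv := inv_tangent_le d0 dp.
  (* The potential and the logarithm cancel; what is left is the convexity gap. *)
  move: conv dp d0; move: (dh h M xp j) (dh h M x0 j) => a b conv a0 b0.
  rewrite -subr_ge0.
  set D2 := drho0 L rho0 (X j) ^+ 2.
  have D20 : 0 <= D2 by exact: sqr_ge0.
  match goal with |- is_true (0 <= ?e) => have -> : e =
    node_weight h M j * (eps ^+ 2 / 2) * D2 *
      (- a^-1 ^+ 2 * (a - b) - (a^-1 - b^-1)) end.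
    by field; rewrite !gt_eqF.
  apply: mulr_ge0; last by rewrite subr_ge0.
  apply: mulr_ge0 D20; apply: mulr_ge0 W0 _.
  by apply: divr_ge0; [exact: sqr_ge0|].
(* Here the scheme enters: it replaces Dh G by the kinetic terms. *)
have kinetic_step : rmax / (2 * tau * (rmax + 1)) * kinetic L M rho0 mob x0 xp
    <= ip_half h M (Dh h G) (mid v)
      + rmax / (2 * time_step t n * (rmax + 1)) * kinetic L M rho0 mob xm x0.
  rewrite /kinetic /ip_half -/h !mulr_sumr -!big_split /=.
  rewrite !big_nat; apply: ler_sum => j /andP[_ jM].
  have Dh_gt0 y : (forall i, (i < M)%N -> y i < y i.+1) -> 0 < Dh h y j.
    by move=> y_inc; rewrite /Dh divr_gt0 // subr_gt0 y_inc.
  set A := Dh h xp j `^ (- (1 / 2)).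
  set B := Dh h x0 j `^ (- (1 / 2)).
  set C := Dh h xm j `^ (- (1 / 2)).
  have A2 : (Dh h xp j)^-1 = A ^+ 2 by rewrite powR_half_inv // Dh_gt0.
  have B2 : (Dh h x0 j)^-1 = B ^+ 2 by rewrite powR_half_inv // Dh_gt0.
  have C2 : (Dh h xm j)^-1 = C ^+ 2 by rewrite powR_half_inv // Dh_gt0.
  have A0 : 0 < A by rewrite powR_gt0 // Dh_gt0.
  have B0 : 0 < B by rewrite powR_gt0 // Dh_gt0.
  rewrite A2 B2 C2 midB.
  set p := mid xp j - mid x0 j; set q := mid x0 j - mid xm j.
  set w := weight L M rho0 mob j.
  have m0 := mob_gt0 (rho0 (mid (lagr L M) j)).
  have w0 : 0 <= w by rewrite divr_ge0 ?sqr_ge0 // ltW.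
  have GE : Dh h G j =
      (2 * r + 1) / (2 * tau * (r + 1)) * w * (A ^+ 2 + B ^+ 2) * p
      - r ^+ 2 / (2 * tau * (r + 1)) * w
        * ((1 + 1 / (2 * r)) * B - 1 / (2 * r) * A) * (C + B) * q.
    have -> : Dh h G j =
        - (eps ^+ 2 / 2) *
            Dh h (fun i => (drho0 L rho0 (X i) * (d xp i)^-1) ^+ 2) j
        + Dh h (fun i => Fpot (rho0 (X i))) j
        + eta * tau * Dh h (fun i => ln (d xp i) - ln (d x0 i)) j.
      by rewrite /Dh /G; ring.
    rewrite -(x_scheme j jM) -/h -/A -/B -/C A2 B2 -/p -/q -/tau -/r -/d.
    rewrite /w /weight.
    move: (Dh h _ j) m0 => lnD m0.
    by field; rewrite !gt_eqF //; lra.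
  rewrite GE taunE.
  have K := kinetic_pointwise C p q r0 rK rmax_le A0 B0.
  rewrite -subr_ge0 in K.
  rewrite -subr_ge0.
  match goal with |- is_true (0 <= ?e) => have -> : e =
   w * h / (2 * tau) * (r * rmax / (rmax + 1) * (C ^+ 2 + B ^+ 2) * q ^+ 2
    - (rmax / (rmax + 1) * (A ^+ 2 + B ^+ 2) * p ^+ 2
    - (2 * r + 1) / (r + 1) * (A ^+ 2 + B ^+ 2) * p ^+ 2
    + r / (2 * (r + 1)) * ((2 * r + 1) * B - A) * (C + B) * q * p)) end.
    by field; rewrite !gt_eqF //; lra.
  apply: mulr_ge0 K; apply: divr_ge0; last by rewrite mulr_ge0 // ltW.
  by rewrite mulr_ge0 // ltW.
rewrite ip_half_Dh ?gt_eqF // -/d in kinetic_step.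
lra.
Qed.
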